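(* Let $E$ be an Archimedean lattice effect algebra and let $u\in E$ be a compact element (of the lattice $E$). Then $u$ is a join of finitely many finite elements of $E$.
   Context: An effect algebra $(E;\oplus,0,1)$ is a set $E$ with two distinct elements $0,1$ and a partially defined binary operation $\oplus$ such that for all $x,y,z\in E$: (Ei) $x\oplus y=y\oplus x$ if $x\oplus y$ is defined; (Eii) $(x\oplus y)\oplus z=x\oplus(y\oplus z)$ if one side is defined; (Eiii) for every $x$ there is a unique $y$, denoted $x'$, with $x\oplus y=1$; (Eiv) if $1\oplus x$ is defined then $x=0$. The partial order is: $x\le y$ iff there is $z$ with $x\oplus z$ defined and $x\oplus z=y$. $E$ is a lattice effect algebra if $(E,\le)$ is a lattice. An atom is a minimal nonzero element of $E$. $E$ is Archimedean if for every $x\in E$, $x\neq0$, there is a greatest positive integer $n$ such that $nx=x\oplus\cdots\oplus x$ ($n$ times) exists. An element $u\in E$ is called finite if either $u=0$ or $u=a_1\oplus\cdots\oplus a_n$ for a finite sequence $a_1,\dots,a_n$ of not necessarily different atoms of $E$. An element $u$ of a lattice $L$ is compact if, for any $D\subseteq L$ whose join $\bigvee D$ exists in $L$, $u\le\bigvee D$ implies $u\le\bigvee F$ for some finite $F\subseteq D$. *)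

(* Defs.v *)
From HB Require Import structures.
From mathcomp Require Import all_boot all_order.
From mathcomp Require Import boolp classical_sets functions cardinality.

Set Implicit Arguments.
Unset Strict Implicit.
Unset Printing Implicit Defensive.

Import Order.TTheory.

Local Open Scope classical_set_scope.

(* The partial operation is a total map into [option]: [oplus x y = Some z]
   means that the sum is defined and equal to z.  The axioms [oplusC] and
   [oplusA] are Kleene equalities: if one side is defined, then so is the
   other one and they agree. *)
Record effectAlgebra := EffectAlgebra {
  effect_sort :> Type;
  ezero : effect_sort;
  eone : effect_sort;
  oplus : effect_sort -> effect_sort -> option effect_sort;
  ezero_neq_eone : ezero <> eone;
  oplusC : forall x y, oplus x y = oplus y x;
  oplusA : forall x y z,
    obind (fun w => oplus w z) (oplus x y) =
    obind (fun w => oplus x w) (oplus y z);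
  oplus_compl : forall x, exists! y, oplus x y = Some eone;
  oplus1_eq0 : forall x, oplus eone x <> None -> x = ezero
}.

Arguments ezero {_}.
Arguments eone {_}.

Definition effect_le (E : effectAlgebra) (x y : E) : Prop :=
  exists z, oplus x z = Some y.

Lemma oplusI (E : effectAlgebra) (x y z w : E) :
  oplus x y = Some w -> oplus x z = Some w -> y = z.
Proof.
move=> xy xz; have [w' [ww' _]] := oplus_compl w.
have key t : oplus x t = Some w ->
    exists2 v, oplus w' x = Some v & oplus t v = Some eone.
  move=> xt; have := oplusA t x w'.
  rewrite (oplusC t x) xt /= ww' (oplusC x w').
  by case: (oplus w' x) => [v|] //= tv; exists v.
have [v xv yv] := key _ xy; have [v' xv' zv] := key _ xz.
move: xv'; rewrite xv => -[vv']; move: zv; rewrite -{}vv' => zv.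
have [c [_ uc]] := oplus_compl v.
have <- : c = y by apply: uc; rewrite oplusC.
by apply: uc; rewrite oplusC.
Qed.

Lemma oplusx0 (E : effectAlgebra) (x : E) : oplus x ezero = Some x.
Proof.
have one0 : oplus eone ezero = Some (eone : E).
  have [y [oy _]] := oplus_compl (eone : E).
  by rewrite -(@oplus1_eq0 _ y) // oy.
have [c [xc _]] := oplus_compl x.
have := oplusA c x ezero; rewrite (oplusC c x) xc /= one0.
case e: (oplus x ezero) => [w|] //= /esym cw.
by rewrite (@oplusI _ c w x eone) // oplusC.
Qed.

Lemma oplus_eq0 (E : effectAlgebra) (x y : E) :
  oplus x y = Some ezero -> x = ezero.
Proof.
move=> xy; apply: oplus1_eq0 => x1; have := oplusA eone x y.
by rewrite xy /= oplusx0 x1.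
Qed.

Lemma effect_le_refl (E : effectAlgebra) (x : E) : effect_le x x.
Proof. by exists ezero; exact: oplusx0. Qed.

Lemma effect_le_anti (E : effectAlgebra) (x y : E) :
  effect_le x y -> effect_le y x -> x = y.
Proof.
move=> [a xa] [b yb]; have := oplusA x a b; rewrite xa /= yb.
case ab: (oplus a b) => [c|] //= /esym xc.
have c0 : c = ezero by exact: oplusI xc (oplusx0 x).
move: xa; rewrite (oplus_eq0 (x := a) (y := b)) ?ab ?c0 // oplusx0.
by case.
Qed.

Lemma effect_le_trans (E : effectAlgebra) (y x z : E) :
  effect_le x y -> effect_le y z -> effect_le x z.
Proof.
move=> [a xa] [b yb]; have := oplusA x a b; rewrite xa /= yb.
by case: (oplus a b) => [c|] //= /esym xc; exists c.
Qed.

Fact effect_display : Order.disp_t. Proof. exact: Order.Disp tt tt. Qed.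

Section EffectOrder.
Variable E : effectAlgebra.

HB.instance Definition _ := gen_eqMixin (effect_sort E).
HB.instance Definition _ := gen_choiceMixin (effect_sort E).

Let le (x y : effect_sort E) : bool := `[< effect_le x y >].

Let le_refl : reflexive le.
Proof. by move=> x; apply/asboolP; exact: effect_le_refl. Qed.

Let le_anti : antisymmetric le.
Proof. by move=> x y /andP[/asboolP xy /asboolP yx]; exact: effect_le_anti. Qed.

Let le_trans : transitive le.
Proof.
by move=> y x z /asboolP xy /asboolP yz; apply/asboolP; exact: effect_le_trans xy yz.
Qed.

HB.instance Definition _ :=
  Order.Le_isPOrder.Build effect_display (effect_sort E) le_refl le_anti le_trans.

End EffectOrder.

Lemma effect_leP (E : effectAlgebra) (x y : E) :
  reflect (exists z, oplus x z = Some y) (x <= y)%O.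
Proof. exact: asboolP. Qed.

Definition is_lattice {d : Order.disp_t} (T : porderType d) : Prop :=
  forall x y : T,
    supremums [set x; y] !=set0 /\ infimums [set x; y] !=set0.

(* A set has at most one supremum, so [s] and [t] are the joins of D and F. *)
Definition is_compact {d : Order.disp_t} {T : porderType d} (u : T) : Prop :=
  forall (D : set T) (s : T), supremums D s -> (u <= s)%O ->
    exists F : set T, [/\ F `<=` D, finite_set F &
      exists2 t, supremums F t & (u <= t)%O].

(* (..(a_1 (+) a_2) (+) ..) (+) a_n, or [None] if it is not defined; the empty
   sum is 0. *)
Definition oplus_seq (E : effectAlgebra) (s : seq E) : option E :=
  if s is a :: s' then
    foldl (fun o b => obind (fun w => oplus w b) o) (Some a) s'
  else Some ezero.

Definition archimedean (E : effectAlgebra) : Prop :=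
  forall x : E, x <> ezero ->
    exists n : nat, [/\ (0 < n)%N, oplus_seq (nseq n x) <> None &
      forall m : nat, (0 < m)%N -> oplus_seq (nseq m x) <> None -> (m <= n)%N].

Definition is_atom (E : effectAlgebra) (a : E) : Prop :=
  a <> ezero /\ forall x : E, x <> ezero -> (x <= a)%O -> x = a.

Definition is_finite_elt (E : effectAlgebra) (u : E) : Prop :=
  u = ezero \/
  exists s : seq E,
    [/\ s <> [::], forall a : E, a \in s -> is_atom a & oplus_seq s = Some u].

(* Main.v *)
(* Let w <= u be an upper bound of the finite elements below the compact
   element u, and v = u - w.  An atom a <= v would give, by induction on n,
   n a <= w for all n (n a is finite and (n + 1) a <= w + a <= u), against the
   Archimedean property.  If v were nonzero without atoms below it, a maximal
   chain C of nonzero elements below v would have infimum 0, so the chain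
   {u - c | c in C} would have supremum u without reaching u, against
   compactness.  Hence v = 0, i.e. u is the supremum of the finite elements
   below it, and compactness extracts finitely many of them. *)
Require Import Defs.
From mathcomp Require Import all_boot all_order.
From mathcomp Require Import boolp classical_sets functions cardinality.

Set Implicit Arguments.
Unset Strict Implicit.

Import Order.TTheory.

Local Open Scope classical_set_scope.

Lemma oplus0x (E : effectAlgebra) (x : E) : oplus ezero x = Some x.
Proof. by rewrite oplusC oplusx0. Qed.

Lemma effect_le0x (E : effectAlgebra) (x : E) : (ezero <= x)%O.
Proof. by apply/effect_leP; exists x; exact: oplus0x. Qed.

Lemma effect_lex0 (E : effectAlgebra) (x : E) : (x <= ezero)%O -> x = ezero.
Proof. by case/effect_leP => z /oplus_eq0. Qed.

Lemma oplus_lel (E : effectAlgebra) (x y z : E) :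
  oplus x y = Some z -> (x <= z)%O.
Proof. by move=> xy; apply/effect_leP; exists y. Qed.

Lemma oplus_ler (E : effectAlgebra) (x y z : E) :
  oplus x y = Some z -> (y <= z)%O.
Proof. by rewrite oplusC; exact: oplus_lel. Qed.

Lemma le_oplus2r (E : effectAlgebra) (z x y t : E) :
  (x <= y)%O -> oplus y z = Some t ->
  exists2 s, oplus x z = Some s & (s <= t)%O.
Proof.
case/effect_leP => d xd yz; have := oplusA d x z.
rewrite (oplusC d x) xd /= yz.
by case: (oplus x z) => [s|] //= /esym ds; exists s => //; exact: oplus_ler ds.
Qed.

(** Writing [y] as the sum of [x] and [e], associativity and cancellation of [x] show that [c] is
    the sum of [e] and [d]. *)
Lemma oplus_le_anti (E : effectAlgebra) (x y c d u : E) :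
  (x <= y)%O -> oplus x c = Some u -> oplus y d = Some u -> (d <= c)%O.
Proof.
case/effect_leP => e xe xc yd; have := oplusA x e d; rewrite xe /= yd.
case ed: (oplus e d) => [f|] //= /esym xf.
by rewrite (oplusI xc xf); exact: oplus_ler ed.
Qed.

Lemma oplus_seq_rcons (E : effectAlgebra) (s : seq E) (a : E) :
  oplus_seq (rcons s a) = obind (fun w => oplus w a) (oplus_seq s).
Proof. by case: s => [|b s] /=; rewrite ?oplus0x // foldl_rcons. Qed.

Lemma total_seq_ubound (d : Order.disp_t) (T : porderType d) (D : set T)
    (s : seq T) :
  total_on D (fun x y => (x <= y)%O) -> D !=set0 -> [set` s] `<=` D ->
  exists2 m, D m & ubound [set` s] m.
Proof.
move=> totD [x0 Dx0]; elim: s => [|x s IHs] sD; first by exists x0.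
have [y /= ys|m Dm sm] := IHs; first by apply: sD; rewrite /= inE ys orbT.
have Dx : D x by apply: sD; rewrite /= mem_head.
have [xm|mx] := totD _ _ Dx Dm.
  by exists m => // y /=; rewrite inE => /predU1P[->|/sm].
exists x => // y /=; rewrite inE => /predU1P[->//|/sm ym].
exact: le_trans ym mx.
Qed.

(** The finite subset given by compactness is bounded by a single member of the chain; nonemptiness
    of [D] covers the case where that subset is empty. *)
Lemma compact_total (d : Order.disp_t) (T : porderType d) (u s : T)
    (D : set T) :
  is_compact u -> total_on D (fun x y => (x <= y)%O) -> D !=set0 ->
  supremums D s -> (u <= s)%O -> exists2 m, D m & (u <= m)%O.
Proof.
move=> hu totD D0 Ds us.
have [F [FD /finite_seqP[r Fr] [t [_ tF] ut]]] := hu D s Ds us.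
have rD : [set` r] `<=` D by rewrite -Fr.
have [m Dm rm] := total_seq_ubound totD D0 rD.
by exists m => //; apply: le_trans ut _; apply: tF; rewrite Fr.
Qed.

(** Hausdorff's maximal principle inside [A]: a union of nested chains is a chain, so Zorn's lemma
    applies. *)
Lemma maximal_total_subset (T : Type) (r : T -> T -> Prop) (A : set T) :
  exists C : set T, [/\ C `<=` A, total_on C r &
    forall B, B `<=` A -> total_on B r -> C `<=` B -> B `<=` C].
Proof.
pose P := [set C : set T | C `<=` A /\ total_on C r].
have [|C [[CA totC] maxC]] := @Zorn_bigcup T P.
  move=> F FP totF; split=> [x [X /FP[XA _] /XA]//|x y [X FX Xx] [Y FY Yy]].
  have [XY|YX] := totF _ _ FX FY.
    by have [_] := FP _ FY; apply => //; exact: XY.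
  by have [_] := FP _ FX; apply => //; exact: YX.
exists C; split=> // B BA totB CB; apply: contrapT => nBC.
by apply: (maxC B).
Qed.

Lemma atomless_chain (E : effectAlgebra) (v : E) :
  v <> ezero -> (forall a : E, is_atom a -> ~ (a <= v)%O) ->
  exists C : set E, [/\ C !=set0, total_on C (fun x y => (x <= y)%O),
    forall c, C c -> c <> ezero /\ (c <= v)%O &
    forall l, lbound C l -> l = ezero].
Proof.
move=> v0 noatom.
have [C [CA totC maxC]] := maximal_total_subset (fun x y : E => (x <= y)%O)
  [set c : E | c <> ezero /\ (c <= v)%O].
(* Adjoining such a [y] keeps [C] a chain, so maximality forces it to be a member already. *)
have lbC y : y <> ezero -> (y <= v)%O -> lbound C y -> C y.
  move=> y0 yv Cy; apply: (maxC (y |` C)); last by left.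
  - by move=> x [->|/CA].
  - move=> x z [->|Cx] [->|Cz]; [by left|left; exact: Cy|right; exact: Cy|].
    exact: totC.
  - by move=> x Cx; right.
have C0 : C !=set0.
  apply: contrapT => nC; apply: (nC); exists v; apply: lbC => // x Cx.
  by case: nC; exists x.
exists C; split=> // l Cl; apply: contrapT => l0.
have lv : (l <= v)%O.
  by have [c Cc] := C0; apply: le_trans (Cl _ Cc) _; case: (CA _ Cc).
(* A nonzero [l] would be an atom: any nonzero [x] below [l] also bounds [C] from below, hence lies
   in [C], hence is above [l]. *)
apply: (noatom l) => //; split=> // x x0 xl.
apply: le_anti; rewrite xl /=; apply: (Cl); apply: lbC => //.
  exact: le_trans xl lv.
by move=> c Cc; apply: le_trans xl _; exact: Cl.
Qed.

Lemma le_compact_has_atom (E : effectAlgebra) (hlat : is_lattice E) (u v : E) :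
  is_compact u -> v <> ezero -> (v <= u)%O ->
  exists2 a : E, is_atom a & (a <= v)%O.
Proof.
move=> hu v0 vu; apply: contrapT => noatom.
have [||C [[c0 Cc0] totC Cv infC]] := @atomless_chain E v => //.
  by move=> a aa av; apply: noatom; exists a.
have compl c : C c -> exists x, oplus c x = Some u.
  by case/Cv => _ cv; apply/effect_leP; exact: le_trans cv vu.
pose D := [set x : E | exists2 c, C c & oplus c x = Some u].
have Du : supremums D u.
  split=> [x [c _ /oplus_ler]//|w Dw].
  (* The bound [w] need not be below [u], so it is replaced by the meet [m] of [w] and [u]. The
     difference [z] of [u] and [m] is then a lower bound of [C], since complementation in [u]
     reverses the order. *)
  have [_ [m [wum mm]]] := hlat w u.
  have mw : (m <= w)%O by apply: wum; left.
  have mu : (m <= u)%O by apply: wum; right.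
  have [z mz] := effect_leP _ _ mu.
  have z0 : z = ezero.
    apply: infC => c Cc; have [x cx] := compl _ Cc.
    have xm : (x <= m)%O.
      apply: mm => y [->|->]; last exact: oplus_ler cx.
      by apply: Dw; exists c.
    by apply: oplus_le_anti xm _ mz; rewrite oplusC.
  by move: mz; rewrite z0 oplusx0 => -[<-].
have [] := compact_total hu _ _ Du (lexx u).
- move=> x y [c Cc cx] [e Ce ey].
  have [ce|ec] := totC _ _ Cc Ce.
    by right; exact: oplus_le_anti ce cx ey.
  by left; exact: oplus_le_anti ec ey cx.
- by have [x cx] := compl _ Cc0; exists x, c0.
(* A member of [D] above [u] equals [u], and cancellation then gives [c] = 0. *)
- move=> x [c Cc cx] ux; case: (Cv _ Cc) => + _; apply.
  have xu : x = u by apply: le_anti; rewrite ux (oplus_ler cx).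
  by apply: (oplusI _ (oplusx0 u)); rewrite oplusC -{1}xu.
Qed.

Lemma archimedean_atom (E : effectAlgebra) (harch : archimedean E)
    (u w v a : E) :
  oplus w v = Some u -> is_atom a -> (a <= v)%O ->
  ~ (forall x : E, is_finite_elt x -> (x <= u)%O -> (x <= w)%O).
Proof.
move=> wv aa av wub.
have multiples n : exists2 x, oplus_seq (nseq n a) = Some x & (x <= w)%O.
  elim: n => [|n [x nx xw]]; first by exists ezero => //; exact: effect_le0x.
  (* Since [a] is below [v], it can be added to [w] without leaving [u]; hence it can also be added
     to [x], which is below [w]. *)
  have [p aw pu] : exists2 p, oplus a w = Some p & (p <= u)%O.
    by apply: le_oplus2r av _; rewrite oplusC.
  have [y xa yp] : exists2 y, oplus x a = Some y & (y <= p)%O.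
    by apply: le_oplus2r xw _; rewrite oplusC.
  have sy : oplus_seq (nseq n.+1 a) = Some y.
    by rewrite -addn1 nseqD cats1 oplus_seq_rcons nx.
  exists y => //; apply: wub; last exact: le_trans yp pu.
  by right; exists (nseq n.+1 a); split=> // b /nseqP[->].
have [n [_ _ nmax]] := harch _ (proj1 aa).
have [x nx _] := multiples n.+1.
by have := nmax n.+1 isT; rewrite nx ltnn => /(_ ltac:(by [])).
Qed.

Theorem lemma2 (E : effectAlgebra) (hlat : is_lattice E)
    (harch : archimedean E) (u : E) (hu : is_compact u) :
  exists F : set E,
    [/\ finite_set F, forall x : E, F x -> is_finite_elt x & supremums F u].
Proof.
pose D := [set x : E | is_finite_elt x /\ (x <= u)%O].
have Du : supremums D u.
  split=> [x []//|w Dw].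
  (* The meet [m] still bounds [D] and has a difference [z] from [u]; an atom below a nonzero [z]
     would contradict [archimedean_atom]. *)
  have [_ [m [wum mm]]] := hlat w u.
  have mw : (m <= w)%O by apply: wum; left.
  have mu : (m <= u)%O by apply: wum; right.
  have [z mz] := effect_leP _ _ mu.
  have [z0|z0] := pselect (z = ezero).
    by move: mz; rewrite z0 oplusx0 => -[<-].
  have [a aa az] := le_compact_has_atom hlat hu z0 (oplus_ler mz).
  exfalso; apply: (archimedean_atom harch mz aa az) => x xfin xu.
  by apply: mm => y [->|->//]; exact: Dw.
(* Compactness only gives [u] below the join [t] of [F]; equality holds because every member of [D]
   is below [u]. *)
have [F [FD finF [t [Ft tF] ut]]] := hu D u Du (lexx u).
have tu : t = u.
  by apply: le_anti; rewrite ut andbT; apply: tF => x /FD[].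
by exists F; split=> [//|x /FD[]//|]; rewrite -tu.
Qed.
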